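(* A binary sextic form $p\in\mathbb{C}[x,y]$ satisfies $N(p)\ge1$ (i.e. $p=f_1^3+f_2^3$ for some non-proportional binary quadratic forms $f_1,f_2$) if and only if one of the following holds: (i) $p=\ell^3q$ where $\ell$ is a linear form and $q$ is a square-free binary cubic form; or (ii) $p$ is similar to $q(x^2,y^2)$ for some square-free binary cubic form $q$.
   Context: A binary cubic form is square-free if it is a product of three pairwise non-proportional linear forms. Two forms $p,p'\in\mathbb{C}[x,y]$ are similar if $p'=p\circ M$ for some invertible linear change $M(x,y)=(\alpha x+\beta y,\gamma x+\delta y)$, $\alpha\delta-\beta\gamma\ne0$. For a binary sextic $p$, $N(p)$ is the number of representations $p=f_1^3+f_2^3$ with $f_1,f_2\in\mathbb{C}[x,y]$ non-proportional quadratic forms, where two representations are counted as the same if the unordered pairs $\{f_1^3,f_2^3\}$ coincide. *)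

(* Defs.v *)
From HB Require Import structures.
From mathcomp Require Import all_boot all_order all_algebra.
From mathcomp Require Import finmap mpoly complex.
From mathcomp Require Import boolp classical_sets cardinality.
From mathcomp Require Import constructive_ereal reals.

Set Implicit Arguments.
Unset Strict Implicit.
Unset Printing Implicit Defensive.

Import Order.TTheory GRing.Theory Num.Theory.
Local Open Scope ring_scope.

(* C[x,y], with x = 'X_0 and y = 'X_1.  A binary form of degree d is a
   p : polyxy R such that p \is d.-homog; this includes p = 0. *)
Notation polyxy R := {mpoly (complex R)[2]}.

Section BinaryForms.
Variable R : realType.
Implicit Types p q f g l : polyxy R.

(* Linear dependence; in particular 0 is proportional to every form. *)
Definition proportional f g : Prop :=
  exists c : complex R, f = c *: g \/ g = c *: f.

Definition square_free_cubic q : Prop :=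
  exists l1 l2 l3 : polyxy R,
    [/\ l1 \is 1.-homog, l2 \is 1.-homog & l3 \is 1.-homog] /\
    [/\ ~ proportional l1 l2, ~ proportional l1 l3, ~ proportional l2 l3
      & q = l1 * l2 * l3].

Definition linear_change (a b c d : complex R) p : polyxy R :=
  p \mPo [tuple a *: 'X_0 + b *: 'X_1; c *: 'X_0 + d *: 'X_1].

Definition similar_form p p' : Prop :=
  exists a b c d : complex R,
    a * d - b * c != 0 /\ p' = linear_change a b c d p.

Definition subst_squares q : polyxy R :=
  q \mPo [tuple 'X_0 ^+ 2; 'X_1 ^+ 2].

Definition is_representation p f1 f2 : Prop :=
  [/\ f1 \is 2.-homog, f2 \is 2.-homog, ~ proportional f1 f2
    & p = f1 ^+ 3 + f2 ^+ 3].

(* Representations up to equality of the unordered pair {f1^3, f2^3}. *)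
Definition representations p : set {fset (polyxy R)} :=
  fun S => exists f1 f2, is_representation p f1 f2 /\
    S = [fset f1 ^+ 3; f2 ^+ 3]%fset.

(* N(p), with value +oo should there be infinitely many representations
   (fset_set is only meaningful on finite sets). *)
Definition Nreps p : \bar R :=
  if `[< finite_set (representations p) >]
  then (#|` fset_set (representations p)|%fset%:R)%:E else +oo%E.

End BinaryForms.

(* Main.v *)
Require Import Defs.
From HB Require Import structures.
From mathcomp Require Import all_boot all_order all_algebra.
From mathcomp Require Import finmap mpoly complex.
From mathcomp Require Import boolp classical_sets cardinality.
From mathcomp Require Import constructive_ereal reals.
From mathcomp Require Import ring.

Import Order.TTheory GRing.Theory Num.Theory.
Local Open Scope ring_scope.

(* Factor f1 ^+ 3 + f2 ^+ 3 over the cube roots of unity.  If f1 and f2 share a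
   linear factor l, this is l ^+ 3 times a square-free cubic.  Otherwise the
   pencil spanned by f1 and f2 contains two independent squares, which a linear
   change turns into x ^+ 2 and y ^+ 2.  Conversely, every square-free cubic is
   a sum of two cubes of independent linear forms, since two triples of
   distinct points on the projective line are projectively equivalent. *)

(** An infinite set of representations is nonempty and has the value [+oo]; for a finite one the
    bound says that its cardinality is positive. The theorem thus becomes a question of
    existence. *)
Lemma Nreps_ge1 (R : realType) (p : polyxy R) :
  (1 <= Nreps p)%E <-> exists f1 f2, is_representation p f1 f2.
Proof.
have reps_ne0 : representations p != set0 <->
    exists f1 f2, is_representation p f1 f2.
  split=> [/set0P[S [f1 [f2 [rep _]]]]|[f1 [f2 rep]]]; first by exists f1, f2.
  by apply/set0P; exists [fset f1 ^+ 3; f2 ^+ 3]%fset; exists f1, f2.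
rewrite -reps_ne0 /Nreps; case: asboolP => [fin|inf].
  rewrite lee_fin (ler_nat _ 1) cardfs_gt0.
  split; apply: contra_neq; first by move=> ->; exact: fset_set0.
  exact: fset_set_set0.
split=> _; last by rewrite leey.
by apply/eqP => reps0; apply: inf; rewrite reps0.
Qed.

(** * Binary forms, linear forms and proportionality *)

Section Binary.
Context {R : realType}.
Local Notation C := (complex R).
Implicit Types (f g h l m n p q : polyxy R) (a b c d s t u v : C).

Definition lin a b : polyxy R := a *: 'X_0 + b *: 'X_1.

(** In degree [k] the exponent of ['X_1] determines the monomial, so each term of [p] contributes to
    a single index [i]. *)
Lemma binary_formE {k p} : p \is k.-homog ->
  exists c : nat -> C,
    p = \sum_(i < k.+1) c i *: ('X_0 ^+ (k - i) * 'X_1 ^+ i).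
Proof.
move=> /dhomogP hom; rewrite (mpolyE p) big_seq.
elim/big_rec: _ => [|m g /hom degm [c ->]].
  by exists (fun=> 0); rewrite big1 // => i _; rewrite scale0r.
have {}degm : (m ord0 + m (lift ord0 ord0) = k)%N.
  by rewrite -degm /= mdegE big_ord_recl big_ord1.
have ltm : (m (lift ord0 ord0) < k.+1)%N by rewrite -degm ltnS leq_addl.
exists (fun i => (if i == m (lift ord0 ord0) then p@_m else 0) + c i).
under [RHS]eq_bigr do rewrite scalerDl.
rewrite big_split /=; congr (_ + _).
rewrite (bigD1 (Ordinal ltm)) //= eqxx big1 => [|i].
  by rewrite addr0 mpolyXE_id big_ord_recl big_ord1 -degm addnK.
by rewrite -val_eqE /= => /negbTE ->; rewrite scale0r.
Qed.

Lemma homog1E {l} : l \is 1.-homog -> exists a b, l = lin a b.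
Proof.
move=> /binary_formE[c ->]; exists (c 0), (c 1).
by rewrite 2!big_ord_recl big_ord0 /= /lin expr1 expr0 mulr1 mul1r addr0.
Qed.

Lemma homog2E {f} : f \is 2.-homog -> exists a b c,
  f = a *: 'X_0 ^+ 2 + b *: ('X_0 * 'X_1) + c *: 'X_1 ^+ 2.
Proof.
move=> /binary_formE[c ->]; exists (c 0), (c 1), (c 2).
rewrite 3!big_ord_recl big_ord0 /= addr0 addrA.
by rewrite (expr0 'X_0) (expr0 'X_1) mulr1 mul1r.
Qed.

Lemma lin_homog a b : lin a b \is 1.-homog.
Proof. by rewrite dhomogD ?dhomogZ // dhomogX /= mdeg1. Qed.

Lemma nprop_indep {f g a b} : ~ proportional f g -> a *: f + b *: g = 0 ->
  a = 0 /\ b = 0.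
Proof.
move=> nfg eq0; have [a0|a_neq0] := eqVneq a 0.
  split=> //; apply/eqP; apply: contra_notT nfg => b_neq0; exists 0; right.
  move: eq0; rewrite a0 !scale0r add0r => /eqP.
  by rewrite scaler_eq0 (negbTE b_neq0) => /eqP.
case: nfg; exists (- (b / a)); left.
apply: (scalerI a_neq0); rewrite scalerA mulrN mulrCA divff // mulr1 scaleNr.
by apply/eqP; rewrite -addr_eq0 eq0.
Qed.

Lemma nprop_comb f g a b c d : ~ proportional f g -> a * d - b * c != 0 ->
  ~ proportional (a *: f + b *: g) (c *: f + d *: g).
Proof.
move=> nfg /eqP det [k [/eqP|/eqP]]; rewrite -subr_eq0 => /eqP eq0;
  apply: det.
- have [||e1 e2] := @nprop_indep f g (a - k * c) (b - k * d) => //.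
    by rewrite -eq0 -!mul_mpolyC; ring.
  by rewrite (subr0_eq e1) (subr0_eq e2); ring.
- have [||e1 e2] := @nprop_indep f g (c - k * a) (d - k * b) => //.
    by rewrite -eq0 -!mul_mpolyC; ring.
  by rewrite (subr0_eq e1) (subr0_eq e2); ring.
Qed.

(** If the determinant vanishes, one coefficient row is a multiple of the other. *)
Lemma nprop_comb_det f g a b c d :
  ~ proportional (a *: f + b *: g) (c *: f + d *: g) -> a * d - b * c != 0.
Proof.
apply: contra_notN => /eqP/subr0_eq det.
have [a0|a_neq0] := eqVneq a 0; last first.
  exists (c / a); right; rewrite scalerDr !scalerA divfK //.
  by congr (_ + _ *: _); apply: (mulfI a_neq0); rewrite det; field.
have [b0|b_neq0] := eqVneq b 0.
  by exists 0; left; rewrite a0 b0 !scale0r addr0.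
exists (d / b); right; rewrite scalerDr !scalerA divfK //.
by congr (_ *: _ + _); apply: (mulfI b_neq0); rewrite -det a0; field.
Qed.

Lemma nprop_mull l f g : ~ proportional (l * f) (l * g) -> ~ proportional f g.
Proof.
by apply: contra_not => -[c [->|->]]; exists c; [left|right];
  rewrite scalerAr.
Qed.

Lemma nprop_mulf l f g : l != 0 -> ~ proportional f g ->
  ~ proportional (l * f) (l * g).
Proof.
move=> l_neq0; apply: contra_not => -[c [eq|eq]]; exists c; [left|right];
  by apply: (mulfI l_neq0); rewrite eq scalerAr.
Qed.

Lemma nprop_linear_change a b c d f g :
  ~ proportional (linear_change a b c d f) (linear_change a b c d g) ->
  ~ proportional f g.
Proof.
by apply: contra_not => -[k [->|->]]; exists k; [left|right];
  rewrite /linear_change comp_mpolyZ.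
Qed.

Lemma comp_lin a b f g : lin a b \mPo [tuple f; g] = a *: f + b *: g.
Proof. by rewrite /lin comp_mpolyD !comp_mpolyZ !comp_mpolyXU. Qed.

Lemma nprop_Xn k : (0 < k)%N ->
  ~ proportional ('X_0 ^+ k : polyxy R) ('X_1 ^+ k).
Proof.
move=> k_gt0; suff eval c (i j : 'I_2) : j != i ->
    ('X_i ^+ k : polyxy R) <> c *: 'X_j ^+ k.
  by move=> [c [|]]; apply: eval.
(* At the point where ['X_i] is 1 and the other variable is 0, the two sides take the values 1 and
   0. *)
move=> ij /(congr1 (fun g => g.@[fun o => (o == i)%:R])) /= /eqP.
rewrite mevalZ !rmorphXn /= !mevalXU eqxx (negbTE ij) expr1n expr0n.
by rewrite (gtn_eqF k_gt0) mulr0 oner_eq0.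
Qed.

Lemma comp_mpolyXn f k (T : 2.-tuple (polyxy R)) :
  (f ^+ k) \mPo T = (f \mPo T) ^+ k.
Proof. exact: rmorphXn. Qed.

Lemma nprop_lin a b c d :
  a * d - b * c != 0 -> ~ proportional (lin a b) (lin c d).
Proof. exact/nprop_comb/(nprop_Xn 1). Qed.

(** * Square-free cubics as sums of two cubes *)

Lemma primitive_cube_root1 : exists w : C,
  [/\ w ^+ 2 = - w - 1, w != 0, w - 1 != 0 & w + 1 != 0].
Proof.
pose s : C := sqrtC (- 3).
have s2 : s ^+ 2 = - 3 by rewrite sqrtCK.
(* The quadratic formula for [w ^+ 2 + w + 1 = 0]. *)
have w0 : ((s - 1) / 2) ^+ 2 = - ((s - 1) / 2) - 1 by field: s2.
move: (_ / _) w0 => w w0.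
have w_neq0 : w != 0.
  apply/eqP => w1; move: w0 => /eqP.
  by rewrite w1 expr0n /= oppr0 add0r eq_sym oppr_eq0 oner_eq0.
exists w; split=> //.
  apply/eqP => /subr0_eq w1; have /eqP : 3 = 0 :> C; last by rewrite pnatr_eq0.
  have -> : 3 = w ^+ 2 + w + 1 by rewrite w1; ring.
  by rewrite w0; ring.
have -> : w + 1 = - w ^+ 2 by ring: w0.
by rewrite oppr_eq0 expf_eq0.
Qed.

(** The factors are [l + w ^+ i * m] for [i] = 0, 1, 2; the determinant of two of them is a
    difference of distinct cube roots of unity. *)
Lemma sum_cubes_square_free l m : l \is 1.-homog -> m \is 1.-homog ->
  ~ proportional l m -> square_free_cubic (l ^+ 3 + m ^+ 3).
Proof.
move=> hl hm nlm; have [w [w0 w_neq0 w_neq1 w_neqN1]] := primitive_cube_root1.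
exists (1 *: l + 1 *: m), (1 *: l + w *: m), (1 *: l + w ^+ 2 *: m).
split; [by split; rewrite dhomogD ?dhomogZ | split].
- by apply: nprop_comb; rewrite // !mul1r.
- apply: nprop_comb => //; rewrite !mul1r.
  have -> : w ^+ 2 - 1 = (w - 1) * (w + 1) by ring.
  by rewrite mulf_neq0.
- apply: nprop_comb => //; rewrite !mul1r mulr1.
  have -> : w ^+ 2 - w = w * (w - 1) by ring.
  by rewrite mulf_neq0.
(* The final [ring] works in the polynomial ring, so the relation for [w] is lifted to constants. *)
- have wP : w%:MP_[2] ^+ 2 = - w%:MP - 1.
    by rewrite -rmorphXn w0; ring.
  by rewrite -!mul_mpolyC; ring: wP.
Qed.

Lemma lin_comb a b a1 b1 a2 b2 :
  a *: lin a1 b1 + b *: lin a2 b2 = lin (a * a1 + b * a2) (a * b1 + b * b2).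
Proof. by rewrite /lin !scalerDr !scalerA addrACA -!scalerDl. Qed.

Lemma lin_span {a1 b1 a2 b2} a b : a1 * b2 - b1 * a2 != 0 ->
  exists s t, lin a b = s *: lin a1 b1 + t *: lin a2 b2.
Proof.
move=> det; exists ((a * b2 - b * a2) / (a1 * b2 - b1 * a2)),
  ((a1 * b - b1 * a) / (a1 * b2 - b1 * a2)).
by rewrite lin_comb; congr lin; field.
Qed.

(** The third factor is [s *: l1 + t *: l2] with [s] and [t] nonzero, which allows the three
    factors, up to scalars, to be matched with those of a sum of two cubes. *)
Lemma square_free_sum_cubes q : square_free_cubic q -> exists m n,
  [/\ m \is 1.-homog, n \is 1.-homog, ~ proportional m n
    & q = m ^+ 3 + n ^+ 3].
Proof.
case=> l1 [l2 [l3 [[h1 h2 h3] [n12 n13 n23 ->]]]].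
have [[a1 [b1 e1]] [a2 [b2 e2]] [a [b e3]]] :=
  And3 (homog1E h1) (homog1E h2) (homog1E h3).
have det : a1 * b2 - b1 * a2 != 0.
  by move: n12; rewrite e1 e2; exact: nprop_comb_det.
have [s [t]] := lin_span a b det; rewrite -e1 -e2 -e3 => {e1 e2 e3} e3.
have s_neq0 : s != 0.
  apply: contra_notN n23 => /eqP s0; exists t; right.
  by rewrite e3 s0 scale0r add0r.
have t_neq0 : t != 0.
  apply: contra_notN n13 => /eqP t0; exists s; right.
  by rewrite e3 t0 scale0r addr0.
have [w [w0 w_neq0 w_neq1 w_neqN1]] := primitive_cube_root1.
(* For the [m] and [n] chosen below, [m ^+ 3 + n ^+ 3] is [k ^+ 3] times this constant times
   [l1 * l2 * l3]; this fixes [k]. *)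
have D_neq0 : 3 * s * t * (w - w ^+ 2) != 0.
  have -> : w - w ^+ 2 = - w * (w - 1) by ring.
  by rewrite !mulf_neq0 ?oppr_eq0 // pnatr_eq0.
(* With w a primitive cube root of 1, m ^+ 3 + n ^+ 3 is the product of m + n,
   m + w n and m + w^2 n, whose combination with weights 1, w, w^2 vanishes;
   m and n are solved from k'(s l1) = m + n and k'(t l2) = w (m + w n), where
   k' = k (1 - w). *)
pose k := 3.-root (3 * s * t * (w - w ^+ 2))^-1.
have k3 : k ^+ 3 * (3 * s * t * (w - w ^+ 2)) = 1 by rewrite rootCK // mulVf.
have k_neq0 : k != 0 by rewrite rootC_eq0 // invr_eq0.
exists ((- k * w * s) *: l1 + (k * w ^+ 2 * t) *: l2),
  ((k * s) *: l1 + (- k * w ^+ 2 * t) *: l2).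
split; rewrite ?dhomogD ?dhomogZ //.
  apply: nprop_comb => //.
  have -> : - k * w * s * (- k * w ^+ 2 * t) - k * w ^+ 2 * t * (k * s) =
    k ^+ 2 * s * t * w ^+ 2 * (w - 1) by ring.
  by rewrite !mulf_neq0 ?expf_neq0.
have wP : w%:MP_[2] ^+ 2 = - w%:MP - 1.
  by rewrite -rmorphXn w0; ring.
by rewrite e3 -[LHS]scale1r -k3 -!mul_mpolyC; ring: wP.
Qed.

(** * Linear substitutions and their inverses *)

Lemma comp_mpolyK p (T U : 2.-tuple (polyxy R)) :
  (forall i, tnth T i \mPo U = 'X_i) -> (p \mPo T) \mPo U = p.
Proof.
move=> TU; have XK (m : 'X_{1..2}) : ('X_[m] \mPo T) \mPo U = 'X_[m].
  rewrite comp_mpolyX big_ord_recl big_ord1.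
  rewrite mpolyXE_id big_ord_recl big_ord1.
  by rewrite (rmorphM (comp_mpoly U)) /= !comp_mpolyXn !TU.
elim/mpolyind: p => [|c m p _ _ IHp]; first by rewrite !comp_mpoly0.
move: 'X_[m] (XK m) => x xK.
rewrite comp_mpolyD comp_mpolyZ comp_mpolyD IHp.
by rewrite (comp_mpolyZ c (x \mPo T)) xK.
Qed.

Lemma linear_changeK a b c d a' b' c' d' p :
  a * a' + b * c' = 1 -> a * b' + b * d' = 0 ->
  c * a' + d * c' = 0 -> c * b' + d * d' = 1 ->
  linear_change a' b' c' d' (linear_change a b c d p) = p.
Proof.
move=> e00 e01 e10 e11; apply: comp_mpolyK => i.
have [->|->] : i = ord0 \/ i = lift ord0 ord0.
- by case: i => [[|[|]]] //= ?; [left|right]; apply: val_inj.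
- by rewrite comp_lin lin_comb e00 e01 /lin scale1r scale0r addr0.
- by rewrite comp_lin lin_comb e10 e11 /lin scale1r scale0r add0r.
Qed.

Lemma comp_diag a b f g (T : 2.-tuple (polyxy R)) :
  (a *: f ^+ 2 + b *: g ^+ 2) \mPo T
    = a *: (f \mPo T) ^+ 2 + b *: (g \mPo T) ^+ 2.
Proof.
by rewrite comp_mpolyD (comp_mpolyZ a) (comp_mpolyZ b) !comp_mpolyXn.
Qed.

Lemma comp_sum_cubes f g (T : 2.-tuple (polyxy R)) :
  (f ^+ 3 + g ^+ 3) \mPo T = (f \mPo T) ^+ 3 + (g \mPo T) ^+ 3.
Proof. by rewrite comp_mpolyD !comp_mpolyXn. Qed.

(** Bridge to case (ii): linear forms in the squares are the quadratic forms without mixed term. *)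
Lemma subst_squares_sum_cubes a b c d :
  subst_squares (lin a b ^+ 3 + lin c d ^+ 3)
    = (a *: 'X_0 ^+ 2 + b *: 'X_1 ^+ 2) ^+ 3
      + (c *: 'X_0 ^+ 2 + d *: 'X_1 ^+ 2) ^+ 3.
Proof. by rewrite /subst_squares comp_sum_cubes !comp_lin. Qed.

(** * Pencils of binary quadratic forms *)

(** Determinant 1, rather than merely nonzero, keeps the later inverse changes of basis free of
    division. *)
Lemma unimodular_completion {s t} : (s != 0) || (t != 0) ->
  exists s' t', s * t' - t * s' = 1.
Proof.
have [-> /= t_neq0|s_neq0 _] := eqVneq s 0.
  by exists (- t^-1), 0; field.
by exists 0, s^-1; field.
Qed.

Lemma quadratic_form_isotropic a b c : exists s t,
  (s != 0) || (t != 0) /\ a * s ^+ 2 + b * (s * t) + c * t ^+ 2 = 0.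
Proof.
have [->|a_neq0] := eqVneq a 0.
  by exists 1, 0; rewrite oner_eq0; split=> //; ring.
pose r := sqrtC (b ^+ 2 - 4 * a * c).
have r2 : r ^+ 2 = b ^+ 2 - 4 * a * c by rewrite sqrtCK.
exists ((r - b) / (2 * a)), 1; rewrite oner_eq0 orbT; split=> //.
by field: r2.
Qed.

Lemma disc0_square a b c : b ^+ 2 = 4 * a * c ->
  exists u v, [/\ a = u ^+ 2, b = 2 * (u * v) & c = v ^+ 2].
Proof.
have [->|a_neq0] := eqVneq a 0.
  rewrite mulr0 mul0r => /eqP; rewrite expf_eq0 /= => /eqP ->.
  by exists 0, (sqrtC c); rewrite sqrtCK; split=> //; ring.
pose r := sqrtC a; have r2 : r ^+ 2 = a by rewrite sqrtCK.
have r_neq0 : r != 0 by rewrite sqrtC_eq0.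
rewrite -r2 => disc; exists r, (b / (2 * r)); split=> //; first by field.
by rewrite expr_div_n disc; field.
Qed.

(* The discriminant is a quadratic form on the pencil spanned by f1 and f2, so
   it has a zero, i.e. the pencil contains a square l^2, l = lin u v.  Writing
   another generator as A l^2 + B l m + G m^2, either G = 0 and l divides the
   whole pencil, or completing the square diagonalizes the pencil. *)
Lemma pencil_normal_form f1 f2 : f1 \is 2.-homog -> f2 \is 2.-homog ->
  ~ proportional f1 f2 ->
  (exists l n1 n2, [/\ l \is 1.-homog, n1 \is 1.-homog, n2 \is 1.-homog,
     f1 = l * n1 & f2 = l * n2]) \/
  (exists u v w z a b c d, [/\ u * z - v * w = 1,
     f1 = a *: lin u v ^+ 2 + b *: lin w z ^+ 2
   & f2 = c *: lin u v ^+ 2 + d *: lin w z ^+ 2]).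
Proof.
move=> /homog2E[a0 [a1 [a2 e1]]] /homog2E[b0 [b1 [b2 e2]]] nf.
(* The arguments are the coefficients in [s], [t] of the discriminant of [s *: f1 + t *: f2]. *)
have [s [t [st_neq0 st0]]] := quadratic_form_isotropic
  (a1 ^+ 2 - 4 * a0 * a2) (2 * a1 * b1 - 4 * (a0 * b2 + a2 * b0))
  (b1 ^+ 2 - 4 * b0 * b2).
have [|u [v [u2 uv v2]]] := @disc0_square
  (s * a0 + t * b0) (s * a1 + t * b1) (s * a2 + t * b2).
  by apply/subr0_eq; rewrite -st0; ring.
have g1E : s *: f1 + t *: f2 = lin u v ^+ 2.
  transitivity ((s * a0 + t * b0) *: 'X_0 ^+ 2
    + (s * a1 + t * b1) *: ('X_0 * 'X_1)
    + (s * a2 + t * b2) *: 'X_1 ^+ 2 : polyxy R).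
    by rewrite e1 e2 -!mul_mpolyC; ring.
  by rewrite u2 uv v2 /lin -!mul_mpolyC; ring.
have [w [z uz1]] : exists w z, u * z - v * w = 1.
  apply: unimodular_completion; apply: contraTT st_neq0.
  rewrite !negb_or !negbK => /andP[/eqP u0 /eqP v0].
  have [|-> ->] := @nprop_indep f1 f2 s t nf; last by rewrite eqxx.
  by rewrite g1E u0 v0 /lin !scale0r addr0 expr0n.
have [s' [t' st1]] := unimodular_completion st_neq0.
(* [A0], [A1], [A2] are the coefficients of the second generator [s' *: f1 + t' *: f2]; [A], [B],
   [G] are its coefficients after ['X_0] and ['X_1] are expressed in [l] and [m]. *)
pose A0 := s' * a0 + t' * b0; pose A1 := s' * a1 + t' * b1.
pose A2 := s' * a2 + t' * b2.
pose A := A0 * z ^+ 2 - A1 * (z * w) + A2 * w ^+ 2.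
pose B := A1 * (z * u + v * w) - 2 * (A0 * (z * v) + A2 * (u * w)).
pose G := A0 * v ^+ 2 - A1 * (u * v) + A2 * u ^+ 2.
pose l := lin u v; pose m := lin w z.
have XE : 'X_0 = z *: l - v *: m.
  by rewrite -[LHS]scale1r -uz1 /l /m /lin -!mul_mpolyC; ring.
have YE : 'X_1 = u *: m - w *: l.
  by rewrite -[LHS]scale1r -uz1 /l /m /lin -!mul_mpolyC; ring.
have g2E : s' *: f1 + t' *: f2 = A *: l ^+ 2 + B *: (l * m) + G *: m ^+ 2.
  transitivity (A0 *: 'X_0 ^+ 2 + A1 *: ('X_0 * 'X_1) + A2 *: 'X_1 ^+ 2
    : polyxy R).
    by rewrite e1 e2 /A0 /A1 /A2 -!mul_mpolyC; ring.
  by rewrite XE YE /A /B /G -!mul_mpolyC; ring.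
have f1E : f1 = t' *: (s *: f1 + t *: f2) - t *: (s' *: f1 + t' *: f2).
  by rewrite -[LHS]scale1r -st1 -!mul_mpolyC; ring.
have f2E : f2 = s *: (s' *: f1 + t' *: f2) - s' *: (s *: f1 + t *: f2).
  by rewrite -[LHS]scale1r -st1 -!mul_mpolyC; ring.
rewrite g1E g2E -/l in f1E f2E; rewrite {}f1E {}f2E.
have [->|G_neq0] := eqVneq G 0; [left|right].
  exists l, ((t' - t * A) *: l + (- (t * B)) *: m),
    ((s * A - s') *: l + (s * B) *: m).
  have hl : l \is 1.-homog by exact: lin_homog.
  have hm : m \is 1.-homog by exact: lin_homog.
  split; [exact: hl | by rewrite dhomogD ?dhomogZ | by rewrite dhomogD ?dhomogZ
    | |]; by rewrite scale0r addr0 -!mul_mpolyC; ring.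
(* Now [B l m + G m^2 = G (m + k l)^2 - G k^2 l^2], and replacing [m] by [m + k l] preserves the
   determinant. *)
pose k := B / (2 * G); have -> : B = 2 * G * k by rewrite /k; field.
exists u, v, (w + k * u), (z + k * v), (t' - t * (A - G * k ^+ 2)), (- (t * G)),
  (s * (A - G * k ^+ 2) - s'), (s * G).
split; first by rewrite -uz1; ring.
  by rewrite /l /m /lin -!mul_mpolyC; ring.
by rewrite /l /m /lin -!mul_mpolyC; ring.
Qed.

End Binary.

(** * Assembly of the two directions *)

Theorem theorem5p3 (R : realType) (p : polyxy R) (hp : p \is 6.-homog) :
  (1 <= Nreps p)%E <->
  ((exists l q : polyxy R,
      [/\ l \is 1.-homog, l != 0, square_free_cubic q & p = l ^+ 3 * q])
   \/
   (exists q : polyxy R,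
      square_free_cubic q /\ similar_form p (subst_squares q))).
Proof.
rewrite Nreps_ge1; split=> [[f1 [f2 [h1 h2 nf ->]]]|].
  have [[l [n1 [n2 [hl hn1 hn2 e1 e2]]]]|] := pencil_normal_form _ _ h1 h2 nf.
    left; exists l, (n1 ^+ 3 + n2 ^+ 3); split=> //.
    (* The zero form is proportional to every form, so [l = 0] would make [f1] and [f2]
       proportional. *)
    - apply: contra_notN nf => /eqP l0; exists 0; left.
      by rewrite e1 l0 mul0r scale0r.
    - apply: sum_cubes_square_free => //; apply: (@nprop_mull _ l).
      by rewrite -e1 -e2.
    - by rewrite e1 e2; ring.
  move=> [u [v [w [z [a [b [c [d [det e1 e2]]]]]]]]]; right.
  exists (lin a b ^+ 3 + lin c d ^+ 3); split.
    apply: sum_cubes_square_free; rewrite ?lin_homog //; apply: nprop_lin.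
    by move: nf; rewrite e1 e2; exact: nprop_comb_det.
  (* The inverse of the matrix with rows [(u, v)] and [(w, z)]: it sends [lin u v] to ['X_0] and
     [lin w z] to ['X_1]. *)
  exists z, (- v), (- w), u; split.
    by rewrite mulrNN [z * u]mulrC det oner_eq0.
  have lE : lin u v \mPo [tuple lin z (- v); lin (- w) u] = 'X_0.
    by rewrite comp_lin lin_comb /lin -[RHS]scale1r -det -!mul_mpolyC; ring.
  have mE : lin w z \mPo [tuple lin z (- v); lin (- w) u] = 'X_1.
    by rewrite comp_lin lin_comb /lin -[RHS]scale1r -det -!mul_mpolyC; ring.
  rewrite subst_squares_sum_cubes /linear_change -!/(lin _ _) e1 e2.
  by rewrite comp_sum_cubes !comp_diag lE mE.
case=> [[l [q [hl l_neq0 /square_free_sum_cubes[m [n [hm hn nmn ->]]] ->]]]|].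
  (* The factor [l ^+ 3] is absorbed into both cubes. *)
  exists (l * m), (l * n); split; rewrite ?(@dhomogM _ _ _ 1 _ 1) //.
    exact: nprop_mulf.
  by ring.
case=> _ [/square_free_sum_cubes[m [n [hm hn nmn ->]]]].
case=> a [b [c [d [det]]]].
have [[m1 [m2 mE]] [n1 [n2 nE]]] := (homog1E hm, homog1E hn).
rewrite mE nE subst_squares_sum_cubes => pM.
set D := a * d - b * c in det.
(* The inverse change, as adjugate over determinant; it carries the representation of
   [subst_squares q] back to [p]. *)
pose N : polyxy R -> polyxy R :=
  linear_change (d / D) (- b / D) (- c / D) (a / D).
have NK g : N (linear_change a b c d g) = g.
  by apply: linear_changeK; rewrite /D; field.
have MK g : linear_change a b c d (N g) = g.
  by apply: linear_changeK; rewrite /D; field.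
have N_nprop g h : ~ proportional g h -> ~ proportional (N g) (N h).
  move=> ngh; apply: (nprop_linear_change a b c d).
  (* Rewriting with MK would unfold N when comparing N g with N h. *)
  suff eq_nprop x y : x = g -> y = h -> ~ proportional x y.
    exact: eq_nprop (MK g) (MK h).
  by move=> -> ->.
have N_homog s t : N (s *: 'X_0 ^+ 2 + t *: 'X_1 ^+ 2) \is 2.-homog.
  rewrite /N /linear_change comp_diag !comp_mpolyXU.
  by rewrite dhomogD ?dhomogZ ?(@dhomogMn _ _ _ 1) ?lin_homog.
exists (N (m1 *: 'X_0 ^+ 2 + m2 *: 'X_1 ^+ 2)),
  (N (n1 *: 'X_0 ^+ 2 + n2 *: 'X_1 ^+ 2)).
split; [exact: N_homog | exact: N_homog | |].
  apply/N_nprop/nprop_comb; first exact: (nprop_Xn 2).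
  by move: nmn; rewrite mE nE; exact: nprop_comb_det.
by rewrite -(NK p) -pM /N /linear_change comp_sum_cubes.
Qed.
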